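(* There is a constant $\alpha>0$ such that for every finite simple graph $G=(V,E)$ without isolated vertices and every function $f:V\to\{0,1\}$ there exists an induced subgraph $H=(U,F)$ of $G$ with $|U|\ge \alpha |V|$ and $\deg_H(u)\equiv f(u)\pmod 2$ for all $u\in U$.
   Context: $\deg_H(u)$ denotes the degree of $u$ in the induced subgraph $H=G[U]$. *)

(* Defs.v *)
From HB Require Import structures.
From mathcomp Require Import all_boot all_order all_algebra.
From mathcomp Require Import reals.

Set Implicit Arguments.
Unset Strict Implicit.
Unset Printing Implicit Defensive.

Record sgraph := SGraph {
  vertex :> finType;
  adj : rel vertex;
  adj_sym : symmetric adj;
  adj_irrefl : irreflexive adj }.

Arguments adj {s} x y.

Definition deg (G : sgraph) (u : G) : nat := #|[set v : G | adj u v]|.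

Definition no_isolated (G : sgraph) : Prop := forall u : G, 0 < deg u.

Section Induced.
Variables (G : sgraph) (U : {set G}).

Definition induced_adj : rel {u : G | u \in U} :=
  fun u v => adj (val u) (val v).

Lemma induced_adj_sym : symmetric induced_adj.
Proof. by move=> u v; exact: adj_sym. Qed.

Lemma induced_adj_irrefl : irreflexive induced_adj.
Proof. by move=> u; exact: adj_irrefl. Qed.

Definition induced : sgraph := SGraph induced_adj_sym induced_adj_irrefl.

End Induced.

(* Main.v *)
Require Import Defs.
From HB Require Import structures.
From mathcomp Require Import all_boot all_order all_algebra.
From mathcomp Require Import reals.
From mathcomp Require Import zify.

(** Write A for the adjacency matrix over F_2.  If D is diagonal and x solves
    (A + D) x = D + f (D also standing for its diagonal), then the support of x
    induces a subgraph with degrees f, while D + f is the parity of the number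
    of neighbours in the support for a vertex outside it.  The diagonal of a
    symmetric matrix over F_2 always lies in its column space, so solvability
    only requires f to lie there.

    Let S be a set of vertices, let B be the set of vertices outside S whose
    number of neighbours in S has parity f, and work inside S and B only.  With
    D = f + deg_S on S, the matrix A + D maps the indicator of S to f whatever
    D is on B.  Hence all 2^|B| choices of D on B give a solution x; as D is
    recovered from x and from its restriction to x, the sum of 2^|x| over all
    admissible sets x is at least 2^|B|.  For a uniformly random S a
    non-isolated vertex falls into B with probability 1/4, so some S has
    |B| >= n/4, and an entropy bound then forces an admissible set of size
    at least n/80. *)

Set Implicit Arguments.
Unset Strict Implicit.
Unset Printing Implicit Defensive.

Import Order.TTheory GRing.Theory Num.Theory.

Lemma odd_card (T : finType) (P : pred T) :
  odd #|P| = \big[addb/false]_i P i.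
Proof.
rewrite -sum1_card (big_morph odd oddD (erefl _)) big_mkcond /=.
by apply: eq_bigr => i _; rewrite unfold_in; case: (P i).
Qed.

Lemma addb_sum_sym (I : finType) (F : I -> I -> bool) :
  (forall i j, F i j = F j i) ->
  \big[addb/false]_i \big[addb/false]_j F i j = \big[addb/false]_i F i i.
Proof.
move=> Fsym; elim: (index_enum I) => [|a s IH]; first by rewrite !big_nil.
rewrite !big_cons.
under [X in _ (+) X = _]eq_bigr do rewrite big_cons Fsym.
by rewrite big_split /= IH -addbA addKb.
Qed.

(** If M y = 0, then 0 = y^T M y = sum_i M_ii y_i, because the off-diagonal terms cancel in pairs
    over F_2 and y_i^2 = y_i. So the diagonal is orthogonal to every column of [cokermx M] and lies
    in the row space, which by symmetry is the column space. *)
Lemma diag_in_colspace (T : finType) (m : rel T) :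
  symmetric m ->
  exists x : pred T,
    forall i, \big[addb/false]_j (x j && m i j) = m i i.
Proof.
move=> msym; pose M : 'M[bool]_#|T| :=
  (\matrix_(i, j) m (enum_val i) (enum_val j))%R.
pose d : 'rV[bool]_#|T| := (\row_i M i i)%R.
have Msym i j : M i j = M j i by rewrite !mxE msym.
have: (d <= M)%MS.
  rewrite submxE; apply/eqP/rowP => k; rewrite !mxE.
  pose y i : bool := cokermx M i k.
  have My i : \big[addb/false]_j (M i j && y j) = false.
    by move/matrixP/(_ i k): (mulmx_coker M); rewrite !mxE.
  transitivity (\big[addb/false]_i \big[addb/false]_j (y i && (M i j && y j))).
    rewrite addb_sum_sym => [|i j]; last by rewrite Msym andbC -andbA andbCA.
    by apply: eq_bigr => i _; rewrite mxE -/(y i) andbCA andbb.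
  by rewrite big1 // => i _; rewrite -big_distrr /= My andbF.
case/submxP=> w dE; exists (fun t => w ord0 (enum_rank t)) => i.
move/rowP/(_ (enum_rank i)): dE; rewrite !mxE enum_rankK => ->.
rewrite (reindex _ (onW_bij _ (enum_val_bij T))) /=.
by apply: eq_bigr => j _; rewrite !mxE enum_valK enum_rankK msym.
Qed.

Lemma sum_expn_card (T : finType) (a b : nat) :
  \sum_(X : {set T}) a ^ #|X| * b ^ (#|T| - #|X|) = (a + b) ^ #|T|.
Proof.
have := @bigA_distr _ 0 1 muln addn T (fun=> a) (fun=> b).
rewrite /= prod_nat_const => ->.
apply: eq_bigr => X _; rewrite (bigID (mem X)) /=; congr (_ * _).
  by rewrite (eq_bigr (fun=> a)) => [|i /= ->]; rewrite ?prod_nat_const.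
rewrite (eq_bigr (fun=> b)) => [|i /negbTE /= ->//].
by rewrite -(cardC (mem X)) addKn prod_nat_const.
Qed.

Section Parity.
Variable G : sgraph.
Implicit Types (S X H : {set G}) (v : G).

Definition parity S v : bool := odd #|[set u in S | adj v u]|.

Lemma parityE S v : parity S v = \big[addb/false]_u ((u \in S) && adj v u).
Proof. by rewrite /parity odd_card; apply: eq_bigr => u _; rewrite [LHS]inE. Qed.

Definition toggle v S : {set G} := [set u | (u == v) (+) (u \in S)].

Lemma toggleK v : involutive (toggle v).
Proof. by move=> S; apply/setP=> u; rewrite !inE addKb. Qed.

Lemma parity_toggle v S u : parity (toggle v S) u = adj u v (+) parity S u.
Proof.
rewrite !parityE (bigD1 v) //= [in RHS](bigD1 v) //= inE eqxx /= addbA.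
congr (_ (+) _); first by case: (v \in S); case: (adj u v).
by apply: eq_bigr => w /negbTE wv; rewrite inE wv.
Qed.

Variable f : G -> bool.

Definition admissible X := [forall u in X, parity X u == f u].

Definition rim S : {set G} := [set v | (v \notin S) && (parity S v == f v)].

Lemma solve_parity S H :
  exists2 X, admissible X &
    forall b, b \in rim S -> b \notin X -> parity X b = (b \in H).
Proof.
pose W := S :|: rim S.
pose D v := f v (+) (if v \in S then parity S v else v \in H).
pose m u v := [&& u \in W, v \in W & if u == v then D u else adj u v].
have msym : symmetric m.
  by move=> u v; rewrite /m andbCA eq_sym adj_sym; case: eqP => // ->.
have [z zE] := diag_in_colspace msym.
(* As [m] sends [z] to its diagonal D and, by [mS] below, S to f, it sends their sum to D + f on W.
   Cutting down to W is harmless since [m] vanishes outside it. *)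
pose X := [set v in W | z v (+) (v \in S)].
have mX u : u \in W ->
    \big[addb/false]_v ((v \in X) && m u v) = parity X u (+) ((u \in X) && D u).
  move=> uW; rewrite parityE (bigD1 u) //= [in RHS](bigD1 u) //=.
  rewrite /m adj_irrefl andbF eqxx uW /= addbC; congr (_ (+) _).
    by apply: eq_bigr => v /negbTE vu; rewrite eq_sym vu inE; case: (v \in W).
(* On S the diagonal term corrects [parity S u] to f; on the rim u lies outside S, so D does not
   enter and the parity is already f. *)
have mS u : u \in W -> \big[addb/false]_v ((v \in S) && m u v) = f u.
  move=> uW; transitivity (parity S u (+) ((u \in S) && D u)).
    rewrite parityE (bigD1 u) //= [in RHS](bigD1 u) //=.
    rewrite /m adj_irrefl andbF eqxx uW /= addbC; congr (_ (+) _).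
    apply: eq_bigr => v /negbTE vu; rewrite eq_sym vu inE.
    by case: (v \in S).
  rewrite /D; move: uW; rewrite !inE; case: (u \in S) => /= [_|/eqP ->].
    by rewrite addbCA addbb addbF.
  by rewrite addbF.
have XE u : u \in W -> parity X u (+) ((u \in X) && D u) = D u (+) f u.
  move=> uW; rewrite -mX // -(mS u uW).
  have -> : D u = m u u by rewrite /m uW eqxx.
  rewrite -zE -big_split /=; apply: eq_bigr => v _.
  rewrite inE /m; case: (v \in W); rewrite ?andbF //=.
  by rewrite andb_addl.
exists X => [|b bB bX].
  apply/forall_inP => u uX; have uW : u \in W by move: uX; rewrite inE => /andP[].
  have := XE u uW; rewrite uX /=.
  by case: (parity X u); case: (D u); case: (f u).
have bW : b \in W by rewrite inE bB orbT.
have := XE b bW; rewrite (negbTE bX) addbF => ->.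
by move: bB; rewrite inE /D => /andP[/negbTE -> _]; rewrite addbAC addbb.
Qed.

Lemma sum_admissible_ge S :
  2 ^ #|rim S| <= \sum_(X | admissible X) 2 ^ #|X|.
Proof.
(* With Y = H :&: X this recovers H: inside X it is read off Y, outside X it is the parity given by
   [solve_parity]. Hence the images for admissible X cover all subsets of the rim. *)
pose decode X (Y : {set G}) :=
  [set b in rim S | if b \in X then b \in Y else parity X b].
rewrite -card_powerset.
apply: (@leq_trans #|\bigcup_(X | admissible X) (decode X @: powerset X)|).
  apply/subset_leq_card/subsetP => H; rewrite powersetE => /subsetP HB.
  have [X Xadm XH] := solve_parity S H.
  apply/bigcupP; exists X => //; apply/imsetP; exists (H :&: X).
    by rewrite powersetE subsetIr.
  apply/setP => b; rewrite [RHS]inE; case: (boolP (b \in rim S)) => [bB|nbB] /=.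
    by rewrite inE; case: (boolP (b \in X)) => [|bX]; rewrite ?andbT // XH.
  by apply: contraNF nbB; apply: HB.
elim/big_rec2: _ => [|X k U _ IH]; first by rewrite cards0.
apply: leq_trans (leq_card_setU _ _) _; apply: leq_add IH.
by rewrite -card_powerset leq_imset_card.
Qed.

(** An exponential moment bound: if |X| <= m then 1 <= 16^(m - |X|), and with n = |G| the sum over
    all X of 2^|X| 16^(n - |X|) is 18^n. The base 16 gives (9/8)^n with 9/8 < 2^(1/4), which beats
    |rim S| >= n/4. *)
Lemma admissible_size_bound S m :
  (forall X, admissible X -> #|X| <= m) ->
  2 ^ #|rim S| * 8 ^ #|G| <= 9 ^ #|G| * 16 ^ m.
Proof.
move=> le_m; rewrite -(leq_pmul2r (expn_gt0 2 #|G|)) -mulnA -expnMn /=.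
rewrite mulnAC -expnMn -[9 * 2]/(2 + 16) -sum_expn_card.
apply: leq_trans (leq_mul (sum_admissible_ge S) (leqnn _)) _.
rewrite !big_distrl /= big_mkcond /=; apply: leq_sum => X _.
case: ifP => // /le_m Xm; rewrite -mulnA leq_mul2l -expnD.
by rewrite leq_exp2l // ?orbT //; have := max_card (mem X); lia.
Qed.

(** Toggling v changes whether v is in S but not the parity at v; toggling a neighbour w does the
    reverse. So toggling v, w, both or neither brings v into the rim. *)
Lemma rim_density v :
  0 < deg v -> #|{set G}| <= 4 * #|[set S | v \in rim S]|.
Proof.
case/card_gt0P=> w; rewrite inE => vw; set P := [set S | _].
have wv : w != v by apply: contraTneq vw => ->; rewrite adj_irrefl.
pose Q := P :|: toggle v @: P.
have leU (u : G) (E : {set {set G}}) : #|E :|: toggle u @: E| <= 2 * #|E|.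
  rewrite mul2n -addnn; apply: leq_trans (leq_card_setU _ _) _.
  by rewrite leq_add2l leq_imset_card.
suff cov : setT \subset Q :|: toggle w @: Q.
  rewrite -cardsT; apply: leq_trans (subset_leq_card cov) _.
  apply: leq_trans (leU w Q) _.
  by rewrite -[4]/(2 * 2) -mulnA leq_mul2l leU.
have mem_im u (E : {set {set G}}) S : (S \in toggle u @: E) = (toggle u S \in E).
  by rewrite -{1}[S](toggleK u) mem_imset //; apply: inv_inj (toggleK u).
apply/subsetP => S _; rewrite !in_setU !mem_im !in_setU !mem_im.
rewrite /P !inE !parity_toggle.
rewrite adj_irrefl vw eqxx [v == w]eq_sym (negbTE wv) /=.
by case: (v \in S); case: (parity S v); case: (f v).
Qed.

Lemma exists_large_rim :
  no_isolated G -> exists S, #|G| <= 4 * #|rim S|.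
Proof.
move=> iso.
case: (boolP [exists S, #|G| <= 4 * #|rim S|]) => [/existsP//|/existsPn small].
exfalso.
have upper : \sum_(S : {set G}) (4 * #|rim S| + 1) <= \sum_(S : {set G}) #|G|.
  by apply: leq_sum => S _; rewrite addn1 ltnNge small.
(* Double counting of the pairs (S, v) with v in [rim S]. *)
have lower : #|G| * #|{set G}| <= \sum_(S : {set G}) 4 * #|rim S|.
  rewrite -big_distrr /=.
  under eq_bigr do rewrite -sum1_card big_mkcond.
  rewrite exchange_big /= big_distrr /= -sum_nat_const.
  apply: leq_sum => v _; rewrite -big_mkcond sum1_card.
  by have := rim_density (iso v); rewrite cardsE.
have : 0 < #|{set G}| by apply/card_gt0P; exists set0.
have cT : #|(fun=> true) : pred {set G}| = #|{set G}| by apply: eq_card.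
move: upper; rewrite big_split /= !sum_nat_const cT muln1 mulnC.
by move/leq_trans/(_ lower); rewrite -[leqRHS]addn0 leq_add2l leqNgt => /negP.
Qed.

Lemma exists_large_admissible :
  no_isolated G -> exists2 X, admissible X & #|G| <= 80 * #|X|.
Proof.
move=> /exists_large_rim[S Slarge].
have adm0 : admissible set0 by apply/forall_inP => u; rewrite inE.
case: (arg_maxnP (fun X : {set G} => #|X|) adm0) => X Xadm Xmax.
exists X => //.
have := admissible_size_bound S Xmax.
(* Twentieth powers allow the integer estimate 9^5 <= 2^16. Comparing exponents of 2 gives 20r + 60n
   <= 64n + 80k, and 5n <= 20r then yields n <= 80k. *)
rewrite -(leq_exp2r _ _ (isT : 0 < 20)) !expnMn -!expnM.
set n := #|G| in Slarge *; set k := #|X|; set r := #|rim S| in Slarge *.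
have -> : 8 ^ (n * 20) = 2 ^ (60 * n).
  by rewrite -[8]/(2 ^ 3) -expnM; congr (_ ^ _); lia.
have -> : 16 ^ (k * 20) = 2 ^ (80 * k).
  by rewrite -[16]/(2 ^ 4) -expnM; congr (_ ^ _); lia.
have le9 : 9 ^ (n * 20) <= 2 ^ (64 * n).
  have -> : n * 20 = 5 * (4 * n) by lia.
  have -> : 64 * n = 16 * (4 * n) by lia.
  have base : 9 ^ 5 <= 2 ^ 16 by vm_compute.
  rewrite (expnM 9) (expnM 2); case: (4 * n) => [|t]; first by rewrite !expn0.
  by rewrite leq_exp2r.
move/leq_trans/(_ (leq_mul le9 (leqnn _))).
rewrite -!expnD leq_exp2l //; lia.
Qed.
End Parity.

Theorem theorem2 (R : realType) :
  exists alpha : R, (0 < alpha)%R /\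
    forall (G : sgraph) (f : G -> 'I_2), no_isolated G ->
      exists U : {set G},
        (alpha * #|G|%:R <= #|U|%:R)%R /\
        forall u : induced U, deg u = f (val u) %[mod 2].
Proof.
exists (80%:R^-1)%R; split=> [|G f iso]; first by rewrite invr_gt0 ltr0n.
have [U /forall_inP Uadm Ularge] :=
  exists_large_admissible (fun v => odd (f v)) iso.
exists U; split.
  by rewrite ler_pdivrMl ?ltr0n // -natrM ler_nat.
move=> u; rewrite !modn2; congr nat_of_bool.
rewrite -(eqP (Uadm _ (valP u))) /parity; congr odd.
(* [val] maps the neighbours of u in [induced U] bijectively onto its neighbours in U. *)
rewrite /deg -(card_imset _ val_inj); apply: eq_card => v.
rewrite !inE; apply/imsetP/andP => [[w + ->]|[vU uv]].
  by rewrite inE => ?; split=> //; apply: valP.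
by exists (Sub v vU); rewrite ?inE.
Qed.
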